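(* Let $k\geq 1$ be an integer. For each integer $l\geq 0$ let $p_l(z)=\sum_{p=0}^l \mathrm{w}(l,p)z^p$ be a real polynomial of degree at most $l$. Suppose that for all integers $l\geq p\geq 1$, $$\sum_{r=0}^{l-p}\binom{2l}{r}\mathrm{w}(l-r,p)\geq 0 .$$ Then for all integers $M,N\geq 0$: (i) if $|M-N|\leq k$, then $\sum_{l\in\mathbb{Z}}\binom{M+N}{M-kl}^2 p_{|l|}(z)=\sum_{p\geq 0}b_p z^p$ with $b_p\geq 0$ for all $p>0$; (ii) $\sum_{l\in\mathbb{Z}}\binom{M+N}{M-kl}\binom{M+N}{N-kl} p_{|l|}(z)=\sum_{p\geq 0}c_p z^p$ with $c_p\geq 0$ for all $p>0$.
   Context: Binomial coefficients $\binom{n}{j}$ are $0$ when $j<0$ or $j>n$, so the sums over $l$ are finite and define polynomials in $z$. *)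

(* Defs.v *)
From mathcomp Require Import all_boot all_order all_algebra.
From mathcomp Require Import classical_sets fsbigop reals.

Set Implicit Arguments.
Unset Strict Implicit.
Unset Printing Implicit Defensive.

Import Order.TTheory GRing.Theory Num.Theory.

(* Binomial coefficient with an integer lower index: 0 when j < 0, and also
   when j > n since 'C(n, m) = 0 for m > n. *)
Definition binz (n : nat) (j : int) : nat :=
  match j with
  | Posz m => 'C(n, m)
  | Negz _ => 0
  end.

Local Open Scope ring_scope.

Definition wpoly (R : realType) (w : nat -> nat -> R) (l : nat) : {poly R} :=
  \poly_(p < l.+1) w l p.

(* Main.v *)
(* Fix p > 0 and let g(l) be the coefficient of z^p in p_|l|. By Vandermonde,
   C(n, i) C(n, c - i) is a nonnegative combination over j of the binomials
   C(c - 2j, i - j); with c = M + N for (i) and c = 2M for (ii), everything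
   reduces to the nonnegativity of sum_l C(m, b - kl) g(l) for |2b - m| <= k.
   That sum is the total weight of the m-step +-1 paths which start at 2b - m
   and end in 2kZ, the endpoint 2kl having weight g(l). Recording the successive
   visits of such a path to kZ gives a simple random walk on Z, and after
   symmetrization a start in [-k, k] becomes a start of that walk at 0, or at
   +-1, i.e. one step away from 0. The total weight is thus a nonnegative
   combination of sums over paths on Z from 0 to 2Z, which are the sums
   sum_l C(2m, m - l) g(l) of the hypothesis. *)
Require Import Defs.
From mathcomp Require Import all_boot all_order all_algebra.
From mathcomp Require Import classical_sets fsbigop reals.
From mathcomp Require Import zify ring.

Set Implicit Arguments.
Unset Strict Implicit.
Unset Printing Implicit Defensive.

Import Order.TTheory GRing.Theory Num.Theory.

Local Open Scope classical_set_scope.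
Local Open Scope ring_scope.

(** * Sums over walks with steps +1 and -1 on the integers *)

Definition step (R : nmodType) (f : int -> R) (x : int) : R :=
  f (x - 1) + f (x + 1).

Lemma iter_stepS (R : nmodType) (f : int -> R) (n : nat) (x : int) :
  iter n.+1 (@step R) f x =
    iter n (@step R) f (x - 1) + iter n (@step R) f (x + 1).
Proof. by []. Qed.

(** [iter n step f x] adds [f] over the endpoints of the n-step walks from [x]; the index [i] counts
    down-steps. *)
Lemma iter_stepE (R : pzRingType) (f : int -> R) (n : nat) (x : int) :
  iter n (@step R) f x =
    \sum_(0 <= i < n.+1) 'C(n, i)%:R * f (x + n%:Z - (i%:Z *+ 2)).
Proof.
elim: n x => [|n IH] x; first by rewrite big_nat1 mul1r subr0 addr0.
rewrite iter_stepS !IH addrC [in RHS]big_nat_recl //.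
under [in RHS]eq_bigr do rewrite binS natrD mulrDl.
rewrite big_split /= [in RHS]addrA; congr (_ + _); last first.
  by apply: eq_bigr => i _; congr (_ * f _); lia.
rewrite [in RHS]big_nat_recr //= (@bin_small n n.+1) // mul0r.
rewrite big_nat_recl // !bin0; congr (_ * f _ + _); first by lia.
by rewrite [RHS]addr0; apply: eq_bigr => i _; congr (_ * f _); lia.
Qed.

Lemma iter_stepD (R : pzRingType) (f g : int -> R) (n : nat) (x : int) :
  iter n (@step R) (fun y => f y + g y) x =
    iter n (@step R) f x + iter n (@step R) g x.
Proof.
by rewrite !iter_stepE -big_split; apply: eq_bigr => i _; rewrite mulrDr.
Qed.

(** The class is closed under sums and [step], the operations of the skeleton recursion. Evenness
    makes [f 1] half of [step f 0], hence nonnegative. *)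
Definition return_nonneg (R : numDomainType) (f : int -> R) : Prop :=
  (forall x, f (- x) = f x) /\ (forall n, 0 <= iter n (@step R) f 0).

Lemma return_nonneg0 (R : numDomainType) : return_nonneg (fun=> 0 : R).
Proof.
by split=> // n; rewrite iter_stepE big1 // => i _; rewrite mulr0.
Qed.

Lemma return_nonnegD (R : numDomainType) (f g : int -> R) :
  return_nonneg f -> return_nonneg g -> return_nonneg (fun x => f x + g x).
Proof.
move=> [f_even f_ge0] [g_even g_ge0]; split=> [x|n].
  by rewrite f_even g_even.
by rewrite iter_stepD addr_ge0.
Qed.

Lemma return_nonneg_step (R : numDomainType) (f : int -> R) :
  return_nonneg f -> return_nonneg (step f).
Proof.
move=> [f_even f_ge0]; split=> [x|n]; last by rewrite -iterSr.
rewrite /step addrC -(f_even (x - 1)) -(f_even (x + 1)).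
by congr (f _ + f _); lia.
Qed.

Lemma return_nonneg_at0 (R : numDomainType) (f : int -> R) :
  return_nonneg f -> 0 <= f 0.
Proof. by case=> _ /(_ 0%N). Qed.

Lemma return_nonneg_at1 (R : numDomainType) (f : int -> R) :
  return_nonneg f -> 0 <= f 1.
Proof.
case=> f_even /(_ 1%N); rewrite /= /step sub0r add0r f_even.
by rewrite -mulr2n pmulrn_lge0.
Qed.

(* H is F transported to the lattice kZ. The function a_d collects, over the
   skeleton walks on Z, the n-step paths whose first visit to kZ is at the
   lower end of the cell [kj, k(j + 1)] containing the start kj + d; by
   reflection, those first reaching the upper end are counted by a_(k - d). *)
Lemma skeleton_walk (R : numDomainType) (k : nat) (F H : int -> R) :
    (0 < k)%N -> return_nonneg F ->
    (forall j, H (k%:Z * j) = F j) ->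
    (forall x, ~~ (k%:Z %| x)%Z -> H x = 0) ->
  forall n, exists a : nat -> int -> R,
    [/\ forall d, return_nonneg (a d), forall j, a k j = 0 &
        forall (j : int) (d : nat), (d <= k)%N ->
          iter n (@step R) H (k%:Z * j + d%:Z) = a d j + a (k - d)%N (j + 1)].
Proof.
move=> k_gt0 F_pos HF H0; elim=> [|n [a [a_pos ak IH]]].
  exists (fun d => if d == 0%N then F else fun=> 0); split=> [d|j|j d le_dk].
  - by case: eqP => // _; exact: return_nonneg0.
  - by rewrite (gtn_eqF k_gt0).
  have [->|d_neq0] := eqVneq d 0%N.
    by rewrite subn0 (gtn_eqF k_gt0) !addr0 /= HF.
  have [->|d_neqk] := eqVneq d k.
    by rewrite subnn eqxx /= add0r -HF; congr (H _); lia.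
  have -> : (k - d == 0)%N = false by lia.
  rewrite addr0 /= H0 //; apply/negP => /dvdz_mod0P.
  by rewrite mulrC modzMDl modz_small; lia.
(* From a lattice point, one step up enters the cell above at offset 1 and one step down enters the
   cell below at offset [k - 1]. *)
have iter0 j : iter n.+1 (@step R) H (k%:Z * j) =
    a 1%N j + a 1%N j + step (a (k - 1)%N) j.
  rewrite iter_stepS.
  have -> : k%:Z * j - 1 = k%:Z * (j - 1) + (k - 1)%N%:Z by lia.
  rewrite IH; last by lia.
  have -> : (k - (k - 1) = 1)%N by lia.
  rewrite subrK (IH j 1%N) //.
  by rewrite /step; ring.
(* Inside a cell the first step changes the offset to [d - 1] or [d + 1]. Offset [k] gets 0: that
   start is counted as offset 0 of the next cell. *)
exists (fun d => if d == 0%N then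
                   fun x => a 1%N x + a 1%N x + step (a (k - 1)%N) x
                 else if (d < k)%N then fun x => a (d - 1)%N x + a d.+1 x
                 else fun=> 0).
split=> [d|j|j d le_dk].
- case: eqP => _; last first.
    by case: ifP => _; [apply: return_nonnegD | apply: return_nonneg0].
  apply: return_nonnegD; first exact: return_nonnegD.
  exact: return_nonneg_step.
- by rewrite ltnn (gtn_eqF k_gt0).
have [->|d_neq0] := eqVneq d 0%N.
  by rewrite subn0 ltnn (gtn_eqF k_gt0) !addr0 iter0.
have [->|d_neqk] := eqVneq d k.
  by rewrite subnn eqxx ltnn add0r -iter0; congr (iter _ _ _ _); lia.
have -> : (k - d == 0)%N = false by lia.
have -> : (d < k)%N by lia.
have -> : (k - d < k)%N by lia.
rewrite iter_stepS.
have -> : k%:Z * j + d%:Z - 1 = k%:Z * j + (d - 1)%N%:Z by lia.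
have -> : k%:Z * j + d%:Z + 1 = k%:Z * j + d.+1%:Z by lia.
rewrite !IH; try lia.
have -> : (k - (d - 1) = (k - d).+1)%N by lia.
have -> : (k - d.+1 = k - d - 1)%N by lia.
by rewrite addrACA [a (k - d).+1 _ + _]addrC.
Qed.

(** * Weights carried by a sublattice *)

Definition spread (R : nmodType) (q : nat) (g : int -> R) (x : int) : R :=
  if (q%:Z %| x)%Z then g (x %/ q%:Z)%Z else 0.

Lemma spreadM (R : nmodType) (q m : nat) (g : int -> R) (x : int) :
  (0 < q)%N -> spread (q * m) g (q%:Z * x) = spread m g x.
Proof.
move=> q_gt0; rewrite /spread PoszM divzMpl //.
by rewrite dvdz_mul2l //; lia.
Qed.

Lemma spread_even (R : nmodType) (q : nat) (g : int -> R) :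
  (forall x, g (- x) = g x) -> forall x, spread q g (- x) = spread q g x.
Proof.
move=> g_even x; rewrite /spread rpredN; case: ifP => // /dvdzP [y ->].
have [->|q_neq0] := eqVneq (Posz q) 0; first by rewrite !mulr0 oppr0.
by rewrite -mulNr !mulzK // g_even.
Qed.

(** By evenness [x] may be taken in the cell [[0, k]]. There [skeleton_walk] at [j = 0] writes the
    sum as [a x 0 + a (k - x) 1], a value at 0 and a value at 1 of [return_nonneg] functions. *)
Lemma iter_step_spread_ge0 (R : numDomainType) (k n : nat) (g : int -> R)
    (x : int) :
  (0 < k)%N -> return_nonneg (spread 2 g) -> `|x| <= k%:Z ->
  0 <= iter n (@step R) (spread (k * 2) g) x.
Proof.
move=> k_gt0 g_pos x_le.
have iter_even m y : iter m (@step R) (spread (k * 2) g) (- y) =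
    iter m (@step R) (spread (k * 2) g) y.
  have g_even z : g (- z) = g z.
    by have := g_pos.1 (2%:Z * z); rewrite -mulrN /spread !dvdz_mulr // !mulKz.
  elim: m y => [|m IH] y; first exact: spread_even.
  rewrite !iter_stepS addrC -(IH (y - 1)) -(IH (y + 1)).
  by rewrite opprB opprD [- y + 1]addrC.
wlog x_ge0 : x x_le / 0 <= x.
  move=> wlog_x; have [x_ge0|x_lt0] := leP 0 x; first exact: wlog_x.
  by rewrite -iter_even; apply: wlog_x; lia.
have lattice j : spread (k * 2) g (k%:Z * j) = spread 2 g j by exact: spreadM.
have off_lattice y : ~~ (k%:Z %| y)%Z -> spread (k * 2) g y = 0.
  move=> y_ndvd; rewrite /spread ifF //; apply: contraNF y_ndvd.
  by apply: dvdz_trans; rewrite PoszM dvdz_mulr.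
have [a [a_pos _ iterE]] := skeleton_walk k_gt0 g_pos lattice off_lattice n.
case: x x_le x_ge0 {iter_even} => // d d_le _.
have := iterE 0 d; rewrite mulr0 !add0r => -> //.
by rewrite addr_ge0 ?return_nonneg_at0 ?return_nonneg_at1.
Qed.

(** * Products of two binomials as sums over walks *)

Lemma mul_bin_subset (n m i : nat) : (i <= m)%N ->
  ('C(n, m) * 'C(m, i) = 'C(n, i) * 'C(n - i, m - i))%N.
Proof.
move=> le_im; have [le_mn|lt_nm] := leqP m n; last first.
  rewrite (bin_small lt_nm); have [le_in|lt_ni] := leqP i n.
    by rewrite (@bin_small (n - i)) ?muln0 //; lia.
  by rewrite (bin_small lt_ni).
(* Multiplied by [i! (m - i)! (n - m)!], both sides become [n!]. *)
apply/eqP; rewrite -(eqn_pmul2r (fact_gt0 i)).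
rewrite -(eqn_pmul2r (fact_gt0 (m - i)%N)) -(eqn_pmul2r (fact_gt0 (n - m)%N)).
apply/eqP.
have E1 := bin_fact le_mn; have E2 := bin_fact le_im.
have E3 := bin_fact (leq_trans le_im le_mn).
have E4 : (m - i <= n - i)%N by lia.
move/bin_fact: E4; have -> : (n - i - (m - i) = n - m)%N by lia.
move=> E4.
transitivity ('C(n, m) * ('C(m, i) * (i`! * (m - i)`!)) * (n - m)`!)%N.
  by ring.
by rewrite E2 -mulnA E1 -E3 -E4; ring.
Qed.

(** Count pairs of subsets A, B of sizes [i] and [c - i] by [j], the size of their intersection:
    choose the intersection, then the symmetric difference, then the part of it in A. The range of
    [j] keeps the truncated subtractions exact. *)
Lemma mul_bin_expand (n c i : nat) : (i <= c)%N ->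
  ('C(n, i) * 'C(n, c - i) =
   \sum_(0 <= j < c.+1 | (j <= i <= c - j))
     'C(n, j) * 'C(n - j, c - j * 2) * 'C(c - j * 2, i - j))%N.
Proof.
move=> le_ic; have [le_in|lt_ni] := leqP i n; last first.
  rewrite bin_small // big1 // => j /andP [le_ji le_icj].
  rewrite -mulnA mul_bin_subset; last by lia.
  by rewrite mulnA -mul_bin_subset // bin_small.
rewrite -{2}(subnKC le_in) -binomial.Vandermonde -(big_mkord xpredT
  (fun j => 'C(i, j) * 'C(n - i, c - i - j))%N) big_distrr /=.
rewrite (big_nat_widen _ _ c.+1); last by lia.
rewrite [LHS]big_mkcond [RHS]big_mkcond; apply: eq_big_nat => j /andP [_ lt_jc].
have [le_ji|lt_ij] := leqP j i; last first.
  by rewrite (bin_small lt_ij) mul0n muln0 if_same.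
have -> : (i <= c - j)%N = (j < (c - i).+1)%N by lia.
case: ifP => //= lt_jci.
rewrite -[RHS]mulnA mul_bin_subset; last by lia.
rewrite [RHS]mulnA -mul_bin_subset // -[RHS]mulnA.
by congr (_ * (_ * 'C(_, _)))%N; lia.
Qed.

Lemma sum_mul_bin_ge0 (R : numDomainType) (k n c : nat) (b : int)
    (g : int -> R) :
  (0 < k)%N -> return_nonneg (spread 2 g) -> `|b *+ 2 - c%:Z| <= k%:Z ->
  0 <= \sum_(0 <= i < c.+1)
         ('C(n, i) * 'C(n, c - i))%:R * spread k g (b - i%:Z).
Proof.
move=> k_gt0 g_pos b_le.
rewrite (eq_big_nat _ _ (F2 := fun i =>
  \sum_(0 <= j < c.+1 | (j <= i <= c - j)%N)
  ('C(n, j) * 'C(n - j, c - j * 2))%:R *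
  ('C(c - j * 2, i - j)%:R * spread k g (b - i%:Z)))); last first.
  move=> i /andP [_ lt_ic]; rewrite mul_bin_expand // natr_sum mulr_suml.
  by apply: eq_bigr => j _; rewrite natrM mulrA.
rewrite (exchange_big_dep_nat xpredT) //=; apply: sumr_ge0 => j _.
rewrite -mulr_sumr mulr_ge0 //.
have [le_jc|lt_cj] := leqP (j * 2) c; last first.
  by rewrite big_pred0 // => i; lia.
(* With [i - j] down-steps the endpoint is [2 (b - i)]. The start [2b - c] does not depend on [j],
   so one bound serves every term. *)
have -> : \sum_(0 <= i < c.+1 | (j <= i <= c - j)%N)
    'C(c - j * 2, i - j)%:R * spread k g (b - i%:Z) =
  iter (c - j * 2) (@step R) (spread (k * 2) g) (b *+ 2 - c%:Z).
  transitivity (\sum_(0 + j <= i < (c - j).+1)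
      'C(c - j * 2, i - j)%:R * spread k g (b - i%:Z)).
    rewrite [RHS](big_nat_widenl _ 0%N) // [RHS](big_nat_widen _ _ c.+1);
      last by lia.
    by apply: eq_bigl => i; rewrite add0n ltnS.
  rewrite iter_stepE big_addn.
  have -> : ((c - j).+1 - j = (c - j * 2).+1)%N by lia.
  apply: eq_big_nat => i _; rewrite addnK; congr (_ * _).
  rewrite [(k * 2)%N]mulnC -(spreadM k g _ (isT : 0 < 2)%N).
  by congr spread; lia.
exact: iter_step_spread_ge0.
Qed.

(** Substitution [i = b - k l]; an [i] that comes from no [l] contributes the default 0 of
    [spread]. *)
Lemma fsum_lattice (R : nmodType) (k c : nat) (b : int) (F : int -> R) :
    (0 < k)%N ->
    (forall l, ~~ (0 <= b - k%:Z * l <= c%:Z) -> F l = 0) ->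
  \sum_(l \in [set: int]) F l = \sum_(0 <= i < c.+1) spread k F (b - i%:Z).
Proof.
move=> k_gt0 F0.
pose q (i : nat) := ((b - i%:Z) %/ k%:Z)%Z.
pose s := [seq q i | i <- index_iota 0 c.+1 & (k%:Z %| b - i%:Z)%Z].
have qK i : (k%:Z %| b - i%:Z)%Z -> k%:Z * q i = b - i%:Z.
  by move=> k_dvd; rewrite mulrC divzK.
have s_uniq : uniq s.
  rewrite map_inj_in_uniq ?filter_uniq ?iota_uniq // => i i'.
  rewrite !mem_filter => /andP [/qK Ei _] /andP [/qK Ei' _] eq_q.
  by move: Ei; rewrite eq_q Ei'; lia.
rewrite -(fsbig_widen [set` s]) //=; last first.
  move=> l [_ /= l_notin]; apply: F0; apply/negP => /andP [l_ge l_le].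
  apply: l_notin; apply/mapP; exists `|(b - k%:Z * l)%R|%N.
    rewrite mem_filter mem_index_iota gez0_abs //.
    apply/andP; split; last by lia.
    by rewrite opprB addrC subrK dvdz_mulr.
  by rewrite /q gez0_abs // opprB addrC subrK mulKz //; lia.
rewrite -fsbig_seq // big_map big_filter big_mkcond.
by apply: eq_bigr => i _.
Qed.

(** * From the hypothesis on [w] to walks, and the conclusion *)

Lemma return_nonneg_spread2 (R : numDomainType) (g : int -> R) :
    (forall x, g (- x) = g x) ->
    (forall m : nat, 0 <= \sum_(0 <= i < (m * 2).+1)
                            'C(m * 2, i)%:R * g (m%:Z - i%:Z)) ->
  return_nonneg (spread 2 g).
Proof.
move=> g_even g_ge0; split=> [|n]; first exact: spread_even.
(* Odd-length walks from 0 end at odd integers, where the weight vanishes. *)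
rewrite iter_stepE; have [n_odd|n_even] := boolP (odd n).
  rewrite big1 // => i _; rewrite /spread ifF ?mulr0 //.
  by apply/negP => /dvdzP [y]; lia.
have -> : n = (n./2 * 2)%N by lia.
have := g_ge0 n./2; congr (0 <= _); apply: eq_bigr => i _; congr (_ * _).
rewrite /spread.
have -> : 0 + (n./2 * 2)%N%:Z - i%:Z *+ 2 = (n./2%:Z - i%:Z) * 2%:Z.
  by lia.
by rewrite dvdz_mull // mulzK.
Qed.

(** Coefficient of [z^p] in [p_|x|]; the guard reproduces the truncation in [wpoly]. *)
Definition wcoef (R : nmodType) (w : nat -> nat -> R) (p : nat) (x : int) : R :=
  if (p <= `|x|)%N then w `|x|%N p else 0.

(** The middle term is 0 because [p > 0], and the two halves are mirror images. Each is the
    hypothesis at [l = m], or 0 if [m < p]. *)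
Lemma sum_central_ge0 (R : numDomainType) (w : nat -> nat -> R) (p m : nat) :
    (0 < p)%N ->
    (forall l : nat, (p <= l)%N ->
       0 <= \sum_(0 <= r < (l - p).+1) 'C(2 * l, r)%:R * w (l - r)%N p) ->
  0 <= \sum_(0 <= i < (m * 2).+1)
         'C(m * 2, i)%:R * wcoef w p (m%:Z - i%:Z).
Proof.
move=> p_gt0 w_ge0.
pose T (i : nat) := 'C(m * 2, i)%:R * wcoef w p (m%:Z - i%:Z).
rewrite -[leRHS]/(\sum_(0 <= i < (m * 2).+1) T i).
have half_ge0 : 0 <= \sum_(0 <= i < m) T i.
  have [le_pm|lt_mp] := leqP p m; last first.
    rewrite big_nat_cond big1 // => i; rewrite andbT => lt_im.
    by rewrite /T /wcoef ifF ?mulr0 //; lia.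
  rewrite (big_cat_nat (n := (m - p).+1)) //=; last by lia.
  rewrite [X in _ + X]big_nat_cond [X in _ + X]big1 ?addr0; last first.
    move=> i; rewrite andbT => lt_im.
    by rewrite /T /wcoef ifF ?mulr0 //; lia.
  have := w_ge0 m le_pm; congr (0 <= _); apply: eq_big_nat => i lt_i.
  rewrite /T /wcoef ifT; last by lia.
  by rewrite mulnC; congr (_ * w _ _); lia.
rewrite (big_cat_nat (n := m)) //=; last by lia.
apply: addr_ge0 => //; rewrite big_ltn; last by lia.
have -> : T m = 0 by rewrite /T /wcoef subrr ifF ?mulr0 //; lia.
rewrite add0r -[m.+1]add0n big_addn.
have -> : ((m * 2).+1 - m.+1 = m)%N by lia.
rewrite big_nat_rev /=; move: half_ge0; congr (0 <= _).
apply: eq_big_nat => i lt_i; rewrite /T -bin_sub; last by lia.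
congr ('C(_, _)%:R * _); first by lia.
by rewrite /wcoef; congr (if (p <= _)%N then w _ p else 0); lia.
Qed.

Theorem theorem3p1 (R : realType) (k : nat) (w : nat -> nat -> R)
    (hk : (1 <= k)%N)
    (hw : forall l p : nat, (1 <= p)%N -> (p <= l)%N ->
       0 <= \sum_(0 <= r < (l - p).+1) 'C(2 * l, r)%:R * w (l - r)%N p) :
  forall M N : nat,
    (`|M%:Z - N%:Z| <= k%:Z ->
       forall p : nat, (0 < p)%N ->
         0 <= (\sum_(l \in [set: int])
                 (binz (M + N) (M%:Z - k%:Z * l) ^ 2)%:R
                   *: wpoly w `|l|%N)`_p) /\
    (forall p : nat, (0 < p)%N ->
       0 <= (\sum_(l \in [set: int])
               (binz (M + N) (M%:Z - k%:Z * l)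
                * binz (M + N) (N%:Z - k%:Z * l))%:R
                 *: wpoly w `|l|%N)`_p).
Proof.
have g_pos p : (0 < p)%N -> return_nonneg (spread 2 (wcoef w p)).
  move=> p_gt0; apply: return_nonneg_spread2 => [x|m].
    by rewrite /wcoef abszN.
  by apply: sum_central_ge0 => // l le_pl; exact: hw.
have wpolyE l p : (wpoly w `|l|%N)`_p = wcoef w p l.
  by rewrite /wpoly /wcoef coef_poly ltnS.
have binz0 n j : ~~ (0 <= j <= n%:Z) -> binz n j = 0%N.
  by case: j => // j j_out; rewrite /binz bin_small //; lia.
move=> M N; split=> [le_MN p p_gt0|p p_gt0].
  rewrite (fsum_lattice (c := M + N) (b := M) hk) => [|l l_out]; last first.
    by rewrite binz0 // scale0r.
  rewrite coef_sum.
  have b_le : `|M%:Z *+ 2 - (M + N)%N%:Z| <= k%:Z by lia.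
  have := sum_mul_bin_ge0 (M + N) hk (g_pos p p_gt0) b_le.
  congr (0 <= _); apply: eq_big_nat => i lt_i; rewrite /spread.
  case: ifP => [k_dvd|_]; last by rewrite mulr0 coef0.
  rewrite coefZ wpolyE [k%:Z * _]mulrC divzK // subKr /=.
  rewrite bin_sub; last by lia.
  by rewrite mulnn.
rewrite (fsum_lattice (c := M * 2) (b := M) hk) => [|l l_out]; last first.
  (* If [M - k l > 2M], then [N - k l > M + N], so the second binomial vanishes. *)
  have [M_out|N_out] : ~~ (0 <= M%:Z - k%:Z * l <= (M + N)%N%:Z) \/
      ~~ (0 <= N%:Z - k%:Z * l <= (M + N)%N%:Z) by lia.
    by rewrite binz0 // mul0n scale0r.
  by rewrite mulnC binz0 // mul0n scale0r.
rewrite coef_sum.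
have b_le : `|M%:Z *+ 2 - (M * 2)%N%:Z| <= k%:Z by lia.
have := sum_mul_bin_ge0 (M + N) hk (g_pos p p_gt0) b_le.
congr (0 <= _); apply: eq_big_nat => i lt_i; rewrite /spread.
case: ifP => [k_dvd|_]; last by rewrite mulr0 coef0.
rewrite coefZ wpolyE [k%:Z * _]mulrC divzK // subKr /=.
congr ((_ * _)%:R * _).
(* The lower indices [2M - i] and [N - M + i] add up to [M + N], so symmetry applies; if
   [N < M - i], both binomials are 0. *)
have [le_MiN|lt_MiN] := leqP (M - i) N; last first.
  by rewrite bin_small ?binz0 //; lia.
have -> : N%:Z - (M%:Z - i%:Z) = (N + i - M)%N%:Z by lia.
rewrite /= -bin_sub; last by lia.
by congr 'C(_, _); lia.
Qed.
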